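(* Let $\hat K\equiv\hat K_\phi\subset\mathbb{R}^d$ be a reference generalized prism. Then the inverse estimate $$\|v\|_{L_\infty(\hat K)}^2\le(32p^2)^d\,\|v\|_{\hat K}^2$$ holds for all $v\in\mathcal{P}_p(\hat K)$, $p\in\mathbb{N}$.
   Context: $\mathbb{N}=\{1,2,\dots\}$; $\|\cdot\|_\omega$ is the $L_2(\omega)$-norm; $\mathcal{P}_p(\omega)$ is the space of polynomials of total degree at most $p$ on $\omega$. Reference generalized prism: let $\hat F^0:=[0,1]^{d-1}$, identified with $[0,1]^{d-1}\times\{0\}\subset\mathbb{R}^d$, and let $\phi:\hat F^0\to\mathbb{R}$ be Lipschitz continuous. A reference generalized prism is a domain $$\hat K\equiv\hat K_\phi:=\{\mathbf{x}\in\mathbb{R}^d:\ 0\le x_i\le1,\ i=1,\dots,d-1,\ 0\le x_d\le\phi(x_1,\dots,x_{d-1})\}$$ with the properties: 1) $[0,1]^d\subset\hat K$; 2) the straight line segment connecting any pair $(\mathbf{x},\mathbf{y})\in\hat F^0\times\hat F$ lies fully in $\hat K$, where $\hat F:=\{\mathbf{x}\in\mathbb{R}^d:\ 0\le x_i\le1,\ i=1,\dots,d-1,\ x_d=\phi(x_1,\dots,x_{d-1})\}$. Standing convention: $\hat\rho:=\sup\{\rho\ge1:\ \hat F^0\times[0,\rho]\subset\hat K\}=1$. *)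

(* Defs.v *)
From HB Require Import structures.
From mathcomp Require Import all_boot all_order all_algebra.
From mathcomp Require Import -(notations) mpoly.
From mathcomp Require Import all_classical all_reals all_analysis.
Set Implicit Arguments.
Unset Strict Implicit.
Unset Printing Implicit Defensive.
Import Order.TTheory GRing.Theory Num.Theory.
Import numFieldNormedType.Exports.
Local Open Scope classical_set_scope.
Local Open Scope ring_scope.

(* Points of R^n are n-tuples, with the sigma-algebra of the library, which is
   generated by the coordinate projections (the Borel sigma-algebra of R^n). *)

Section LebesgueRn.
Variable R : realType.

Definition snoc n (z : n.-tuple R * R) : n.+1.-tuple R :=
  [tuple of rcons z.1 z.2].

Lemma tnth_snoc_lift n (z : n.-tuple R * R) (i : 'I_n) :
  tnth (snoc z) (lift ord_max i) = tnth z.1 i.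
Proof.
by rewrite !(tnth_nth 0) /= /bump leqNgt ltn_ord add0n nth_rcons size_tuple
   ltn_ord.
Qed.

Lemma tnth_snoc_max n (z : n.-tuple R * R) : tnth (snoc z) ord_max = z.2.
Proof. by rewrite (tnth_nth 0) /= nth_rcons size_tuple ltnn eqxx. Qed.

Lemma measurable_snoc n : measurable_fun [set: n.-tuple R * R] (@snoc n).
Proof.
apply/measurable_fun_tnthP => i; have [j ->|->] := unliftP ord_max i.
- rewrite (_ : _ \o _ = (fun t => tnth t j) \o fst); last first.
    by apply/funext => z /=; rewrite tnth_snoc_lift.
  exact: (measurableT_comp (measurable_tnth j)).
- rewrite (_ : _ \o _ = snd); first exact: measurable_snd.
  by apply/funext => z /=; rewrite tnth_snoc_max.
Qed.

Section snoc_measure.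
Variables (n : nat) (mu : {measure set (n.-tuple R) -> \bar R}).

Definition snoc_measure : set (n.+1.-tuple R) -> \bar R :=
  pushforward (mu \x @lebesgue_measure R)%E (@snoc n).

Let snoc_measure0 : snoc_measure set0 = 0%E.
Proof. by rewrite /snoc_measure /pushforward preimage_set0 measure0. Qed.

Let snoc_measure_ge0 A : (0 <= snoc_measure A)%E.
Proof. by rewrite /snoc_measure /pushforward measure_ge0. Qed.

Let snoc_measure_sigma_additive : semi_sigma_additive snoc_measure.
Proof.
pose m := measure_function_pushforward__canonical__measure_function_Measure
  (mu \x @lebesgue_measure R)%E (@measurable_snoc n).
exact: (@measure_semi_sigma_additive _ _ _ m).
Qed.

HB.instance Definition _ := isMeasure.Build _ _ _
  snoc_measure snoc_measure0 snoc_measure_ge0 snoc_measure_sigma_additive.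
End snoc_measure.

(* The n-dimensional Lebesgue measure, as the n-fold product of the
   one-dimensional one (cf. lebesgueRn_box for its values on boxes). *)
Fixpoint lebesgueRn n : {measure set (n.-tuple R) -> \bar R} :=
  match n with
  | 0 => \d_([tuple] : 0.-tuple R)
  | n.+1 => snoc_measure (lebesgueRn n)
  end.

Lemma measurable_box n (A : 'I_n -> set R) : (forall i, measurable (A i)) ->
  measurable [set x : n.-tuple R | forall i, A i (tnth x i)].
Proof.
move=> mA; rewrite [X in measurable X](_ : _ = \bigcap_(i in [set: 'I_n])
   ((fun x : n.-tuple R => tnth x i) @^-1` A i)); last first.
  by apply/seteqP; split => [x Ax i _|x Ax i]; apply: Ax.
apply: fin_bigcap_measurable => // i _.
by rewrite -[X in measurable X]setTI; exact: measurable_tnth.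
Qed.

Lemma lebesgueRn_box n (A : 'I_n -> set R) : (forall i, measurable (A i)) ->
  lebesgueRn n [set x | forall i, A i (tnth x i)] =
  (\prod_(i < n) lebesgue_measure (A i))%E.
Proof.
elim: n A => [|n IHn] A mA.
  rewrite big_ord0 /= diracE (_ : _ \in _ = true)//.
  by apply/mem_set => -[].
rewrite big_ord_recr /= /snoc_measure /pushforward.
pose B (i : 'I_n) := A (lift ord_max i).
have mB i : measurable (B i) by exact: mA.
rewrite (_ : _ @^-1` _ = [set x | forall i, B i (tnth x i)] `*` A ord_max); last first.
  apply/seteqP; split => z /=.
    move=> Az; split => [i|]; last by rewrite -tnth_snoc_max; exact: Az.
    by rewrite /= -tnth_snoc_lift; exact: (Az (lift ord_max i)).
  move=> [Az1 Az2] i; have [j ->|->] := unliftP ord_max i.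
    by rewrite tnth_snoc_lift; exact: Az1.
  by rewrite tnth_snoc_max.
rewrite product_measure1E; [|exact: measurable_box|exact: mA].
rewrite IHn//; congr (_ * _)%E; apply: eq_bigr => i _.
congr (lebesgue_measure (A _)).
by apply/val_inj; rewrite /= /bump leqNgt ltn_ord.
Qed.

End LebesgueRn.

Section Norms.
Variables (R : realType) (n : nat).
Implicit Types (w : set (n.-tuple R)) (v : n.-tuple R -> R).

(* v \_ w extends v by 0 outside w, so these are the norms of v on w only;
   the supremum norm is the essential one. *)
Definition normL2 w v : \bar R := Lnorm (lebesgueRn R n) 2%:E (EFin \o (v \_ w)).

Definition normLoo w v : \bar R :=
  Lnorm (lebesgueRn R n) +oo%E (EFin \o (v \_ w)).

(* msize is the total degree plus one (and 0 for the zero polynomial). *)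
Definition polyfun (p : nat) w : set (n.-tuple R -> R) :=
  [set v | exists2 P : mpoly n R, (msize P <= p.+1)%N &
     forall x, w x -> v x = meval (tnth x) P].

End Norms.

Section Prism.
Variable R : realType.

Definition unit_cube n : set (n.-tuple R) :=
  [set x | forall i, 0 <= tnth x i <= 1].

Definition dist2 n (x y : n.-tuple R) : R :=
  Num.sqrt (\sum_(i < n) (tnth x i - tnth y i) ^+ 2).

Definition segment_point n (x y : n.-tuple R) (t : R) : n.-tuple R :=
  [tuple (1 - t) * tnth x i + t * tnth y i | i < n].

(* Ambient dimension d = n.+1: base x collects the first d - 1 coordinates of
   x and height x is the last one. *)
Definition base n (x : n.+1.-tuple R) : n.-tuple R :=
  [tuple tnth x (lift ord_max i) | i < n].

Definition height n (x : n.+1.-tuple R) : R := tnth x ord_max.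

Variables (n : nat) (phi : n.-tuple R -> R).

(* Only the values of phi on the unit cube matter. *)
Definition lipschitz_on_cube : Prop :=
  exists L : R, forall x y, unit_cube x -> unit_cube y ->
    `|phi x - phi y| <= L * dist2 x y.

Definition prism : set (n.+1.-tuple R) :=
  [set x | unit_cube (base x) /\ 0 <= height x <= phi (base x)].

Definition bottom_face : set (n.+1.-tuple R) :=
  [set x | unit_cube (base x) /\ height x = 0].

Definition top_face : set (n.+1.-tuple R) :=
  [set x | unit_cube (base x) /\ height x = phi (base x)].

Definition cylinder (rho : R) : set (n.+1.-tuple R) :=
  [set x | unit_cube (base x) /\ 0 <= height x <= rho].

Definition rho_hat : R :=
  sup [set rho : R | 1 <= rho /\ cylinder rho `<=` prism].

Record reference_prism : Prop := ReferencePrism {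
  prism_lipschitz : lipschitz_on_cube ;
  prism_cube : @unit_cube n.+1 `<=` prism ;
  prism_segment : forall x y, bottom_face x -> top_face y ->
    forall t : R, 0 <= t <= 1 -> prism (segment_point x y t) ;
  prism_rho_hat : rho_hat = 1 }.

End Prism.

(* Main.v *)
(* Around each point z of the prism there is a pyramid with apex z, based on
   the bottom or on the top face of the unit cube, of height |h| >= 1/2 and
   contained in the prism: the bottom base works because the prism contains the
   segments from the bottom face to the point of the graph of phi above z, and
   the top base works for z in the lower half of the unit cube.  In the
   coordinates (b, s) |-> z + s (b - z), with b in the base and s in [0, 1], the
   volume of the pyramid is |h| s^n db ds, and the polynomial restricts to a
   polynomial q_b of degree at most p on each ray from the apex.  It thus
   suffices to bound q(0)^2 by the integral of q(s)^2 s^n over [0, 1].  If k is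
   the reproducing kernel at 0 for this weight, Cauchy-Schwarz gives the
   constant k(0) = (n+1) binomial(n+1+p, p)^2 <= (n+1) (2p)^(2(n+1)), and
   2 k(0) <= (32 p^2)^(n+1), where the 2 accounts for |h| >= 1/2. *)
From HB Require Import structures.
Require Import Defs.
From mathcomp Require Import all_boot all_order all_algebra.
From mathcomp Require Import -(notations) mpoly.
From mathcomp Require Import all_classical all_reals all_analysis.
From mathcomp Require Import measurable_realfun ess_sup_inf qpoly ring lra.
Set Implicit Arguments.
Unset Strict Implicit.
Unset Printing Implicit Defensive.
Import Order.TTheory GRing.Theory Num.Theory.
Import numFieldNormedType.Exports.
Local Open Scope classical_set_scope.
Local Open Scope ring_scope.

(** * Coefficients of the one-dimensional kernel *)

(* The coefficients c_j of the kernel are the residues of the rational function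
   sum_j c_j / (x + j) = A prod_i (x - d - i) / prod_j (x + j), which vanishes at
   d + 1, ..., d + p and is normalized by A to take the value 1 at d. *)
Lemma partial_fraction_kernel (R : realFieldType) (d p : nat) : (0 < d)%N ->
  exists k : {poly R}, [/\ (size k <= p.+1)%N,
    k`_0 = d%:R * \prod_(i < p) ((d + i.+1)%:R / i.+1%:R) ^+ 2 &
    forall i, (i <= p)%N ->
      \sum_(j < p.+1) k`_j / (d + i + j)%:R = (i == 0%N)%:R].
Proof.
move=> d_gt0.
pose D (x : R) := \prod_(j < p.+1) (x + j%:R).
pose M (x : R) := \prod_(i < p) (x - (d + i.+1)%:R).
pose A := D d%:R / M d%:R.
pose N : {poly R} := A *: \prod_(i < p) ('X - (d + i.+1)%:R%:P).
pose q (j : 'I_p.+1) : {poly R} :=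
  \prod_(i < p.+1 | i != j :> nat) ('X - (- i%:R)%:P).
pose c (j : 'I_p.+1) := N.[- j%:R] / (q j).[- j%:R].
have NE x : N.[x] = A * M x.
  by rewrite hornerZ horner_prod; congr (_ * _); apply: eq_bigr => i _;
    rewrite hornerXsubC.
have D_neq0 m : (0 < m)%N -> D m%:R != 0.
  move=> m_gt0; apply/prodf_neq0 => i _.
  by rewrite -natrD pnatr_eq0 addn_eq0 negb_and -lt0n m_gt0.
have M_neq0 : M d%:R != 0.
  apply/prodf_neq0 => i _.
  by rewrite subr_eq0 eqr_nat -[X in X == _]addn0 eqn_add2l.
have qE (j : 'I_p.+1) x : (x + j%:R) * (q j).[x] = D x.
  rewrite /D (bigD1 j)//=; congr (_ * _); rewrite horner_prod.
  by apply: eq_bigr => i _; rewrite hornerXsubC opprK.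
(* Lagrange interpolation at the [p.+1] nodes 0, -1, ..., -p is exact because [N] has degree at most
   [p]. *)
have interp x : N.[x] = \sum_(j < p.+1) c j * (q j).[x].
  have inj : injective (fun i : nat => - i%:R : R).
    by move=> i j /oppr_inj/eqP; rewrite eqr_nat => /eqP.
  have sN : (size N <= p.+1)%N.
    by rewrite (leq_trans (size_scale_leq _ _))// size_prod_XsubC
      -[index_enum _]enumT size_enum_ord.
  rewrite {1}(lagrange_gen (ltn0Sn p) inj sN) horner_sum.
  by apply: eq_bigr => j _; rewrite lagrangeE//= !hornerM !hornerC mulrA.
exists (\poly_(j < p.+1) c (inord j)); split.
- exact: size_poly.
- have in0 : nat_of_ord (inord 0 : 'I_p.+1) = 0%N by rewrite inordK.
  have -> : (\poly_(j < p.+1) c (inord j))`_0 = c (inord 0) by rewrite coef_poly.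
  rewrite /c /q in0 mulr0n oppr0 NE.
  have -> : (\prod_(i < p.+1 | i != 0 :> nat) ('X - (- i%:R)%:P)).[0]
      = \prod_(i < p) i.+1%:R :> R.
    rewrite horner_prod big_mkcond big_ord_recl/= mul1r.
    by apply: eq_bigr => i _; rewrite hornerXsubC opprK add0r.
  (* Both D(d) / (d p!) and M(0) / M(d) equal the product of the (d + i) / i for 1 <= i <= p, hence
     the square; the signs in the second quotient cancel. *)
  rewrite /A /D big_ord_recl/= addr0.
  rewrite -!mulrA; congr (_ * _); rewrite /M.
  rewrite -!prodfV -!big_split/=; apply: eq_bigr => i _.
  have i0 : i.+1%:R != 0 :> R by rewrite pnatr_eq0.
  rewrite /bump/= add1n natrD.
  by field; rewrite nat1r i0 opprD addrA subrr add0r oppr_eq0 i0.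
- move=> i lep.
  have di0 : (0 < d + i)%N by rewrite addn_gt0 d_gt0.
  transitivity (N.[(d + i)%:R] / D (d + i)%:R).
    rewrite interp mulr_suml; apply: eq_bigr => j _.
    rewrite coef_poly ltn_ord inord_val -(qE j (d + i)%:R) -natrD.
    have : (q j).[(d + i)%:R] != 0.
      by apply: contraNneq (D_neq0 _ di0) => q0; rewrite -(qE j) q0 mulr0.
    have : (d + i + j)%:R != 0 :> R.
      by rewrite pnatr_eq0 addn_eq0 negb_and -lt0n di0.
    by move=> dij qj; field; rewrite qj -!natrD.
  rewrite NE; case: i lep di0 => [_ _|i lep di0].
    by rewrite addn0 /A mulfVK// divff// D_neq0.
  by rewrite /M (bigD1 (Ordinal lep))//= subrr mul0r mulr0 mul0r.
Qed.

(** The product is binomial(d + p, p). Raising [d] by one multiplies it by (d + 1 + p) / (d + 1) <=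
    p + 1. *)
Lemma prod_ratio_le (R : realFieldType) (d p : nat) :
  \prod_(i < p) ((d + i.+1)%:R / i.+1%:R) <= p.+1%:R ^+ d :> R.
Proof.
elim: d => [|d IHd].
  by rewrite expr0 big1// => i _; rewrite add0n divff// pnatr_eq0.
have telescope : \prod_(i < p) ((d.+1 + i.+1)%:R / (d + i.+1)%:R)
    = (d.+1 + p)%:R / d.+1%:R :> R.
  elim: p {IHd} => [|p IHp]; first by rewrite big_ord0 addn0 divff// pnatr_eq0.
  by rewrite big_ord_recr IHp/= mulrC (addSnnS d p) mulrA mulfVK.
rewrite (eq_bigr (fun i : 'I_p => (d + i.+1)%:R / i.+1%:R *
    ((d.+1 + i.+1)%:R / (d + i.+1)%:R))); last first.
  by move=> i _; rewrite [RHS]mulrC mulrA mulfVK// addnS pnatr_eq0.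
rewrite big_split/= telescope exprSr ler_pM//.
  by apply: prodr_ge0 => i _; rewrite divr_ge0.
by rewrite ler_pdivrMr ?ltr0n// -natrM ler_nat mulSn leq_add2l leq_pmulr.
Qed.

(** * The weight s^n on [0, 1] and the bound of q(0)^2 *)

Section Moment.
Variables (R : realType) (n : nat).
Implicit Types q : {poly R}.

(* The integral of q(s) s^n over [0, 1], see integral_moment. *)
Definition moment q : R := \sum_(i < size q) q`_i / (n.+1 + i)%:R.

Lemma momentE N q : (size q <= N)%N ->
  moment q = \sum_(i < N) q`_i / (n.+1 + i)%:R.
Proof.
move=> sqN; rewrite /moment (big_ord_widen N (fun i => q`_i / (n.+1 + i)%:R))//.
rewrite big_mkcond; apply: eq_bigr => i _; case: ltnP => // si.
by rewrite nth_default// mul0r.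
Qed.

Lemma moment_is_linear : linear_for *%R moment.
Proof.
move=> a q r; pose N := maxn (size q) (size r).
have sq : (size q <= N)%N by rewrite leq_maxl.
have sr : (size r <= N)%N by rewrite leq_maxr.
have sqr : (size (a *: q + r)%R <= N)%N.
  rewrite (leq_trans (size_polyD _ _))// geq_max sr andbT.
  exact: leq_trans (size_scale_leq _ _) sq.
rewrite !(@momentE N)// mulr_sumr -big_split/=; apply: eq_bigr => i _.
by rewrite coefD coefZ mulrDl mulrA.
Qed.

HB.instance Definition _ :=
  GRing.isLinear.Build R {poly R} R _ moment moment_is_linear.

Lemma momentD q r : moment (q + r) = moment q + moment r.
Proof. exact: linearD. Qed.

Lemma momentZ a q : moment (a *: q) = a * moment q.
Proof. exact: linearZ. Qed.

Lemma momentXn m : moment 'X^m = (n.+1 + m)%:R^-1.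
Proof.
rewrite /moment size_polyXn big_ord_recr/= big1 => [|i _].
  by rewrite coefXn eqxx add0r mul1r.
by rewrite coefXn ltn_eqF// mul0r.
Qed.

(** The hypothesis on [k] says that X^i [k] has moment 1 for i = 0 and 0 for 0 < i <= p. By
    linearity, [k] then represents evaluation at 0. *)
Lemma moment_kernel p q (k : {poly R}) : (size q <= p.+1)%N -> (size k <= p.+1)%N ->
  (forall i, (i <= p)%N ->
     \sum_(j < p.+1) k`_j / (n.+1 + i + j)%:R = (i == 0%N)%:R) ->
  moment (q * k) = q`_0.
Proof.
move=> sq sk kP.
have repr (r : {poly R}) : (size r <= p.+1)%N -> r = \sum_(i < p.+1) r`_i *: 'X^i.
  by move=> sr; rewrite -poly_def; apply/polyP => i; rewrite coef_poly;
    case: ltnP => // pi; rewrite nth_default// (leq_trans sr).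
rewrite {1}(repr q sq) mulr_suml linear_sum/=.
transitivity (\sum_(i < p.+1) q`_i * (i == 0 :> nat)%:R).
  apply: eq_bigr => i _; rewrite -kP -1?ltnS// {1}(repr k sk) mulr_sumr linear_sum/=.
  rewrite mulr_sumr; apply: eq_bigr => j _.
  by rewrite -scalerAl -scalerAr -exprD !linearZ/= momentXn addnA.
by rewrite big_ord_recl/= mulr1 big1 ?addr0// => i _; rewrite mulr0.
Qed.

Lemma integral_moment q :
  (\int[lebesgue_measure]_(s in `[0%R, 1%R]) (q.[s] * s ^+ n)%:E)%E
  = (moment q)%:E.
Proof.
(* An antiderivative of q(s) s^n; all its exponents are positive, so it vanishes at 0. *)
pose F : {poly R} := \sum_(i < size q) (q`_i / (n.+1 + i)%:R) *: 'X^(n.+1 + i).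
have dF : F^`() = q * 'X^n.
  rewrite /F raddf_sum/= -[in RHS](coefK q) poly_def mulr_suml.
  apply: eq_bigr => i _; rewrite derivZ derivXn addSn/= -scalerAl -exprD addnC.
  by rewrite -scalerMnr scalerMnl -[_ *+ _]mulr_natr mulfVK ?pnatr_eq0.
under eq_integral do rewrite -hornerXn -hornerM -dF.
rewrite (@continuous_FTC2 _ _ (horner F))//.
- rewrite -EFinB; congr EFin; rewrite /F !horner_sum -sumrB; apply: eq_bigr => i _.
  by rewrite !hornerZ !hornerXn expr1n mulr1 expr0n addSn mulr0 subr0.
- apply: continuous_subspaceT; exact: continuous_horner.
- split => [x _||].
  + exact: derivable_horner.
  + by apply: cvg_at_right_filter; exact: continuous_horner.
  + by apply: cvg_at_left_filter; exact: continuous_horner.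
- by move=> x _; rewrite derivE.
Qed.

(** The coefficients do not show this positivity; the integral representation does. *)
Lemma moment_sqr_ge0 q : 0 <= moment (q ^+ 2).
Proof.
rewrite -lee_fin -integral_moment; apply: integral_ge0 => s /=.
rewrite in_itv/= => /andP[s0 _].
by rewrite lee_fin mulr_ge0 ?exprn_ge0// horner_exp sqr_ge0.
Qed.

(** Cauchy-Schwarz for the form [moment (q * r)]: since [k] represents evaluation at 0, its own
    squared norm is k(0) = [K]. *)
Lemma horner0_sqr_le p q : (0 < p)%N -> (size q <= p.+1)%N ->
  2 * q.[0] ^+ 2 <= (32 * p%:R ^+ 2) ^+ n.+1 * moment (q ^+ 2).
Proof.
move=> p_gt0 sq.
have [k [sk k0 kP]] := @partial_fraction_kernel R n.+1 p isT.
set K := k`_0 in k0.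
have K_gt0 : 0 < K.
  rewrite k0 mulr_gt0 ?ltr0n//; apply: prodr_gt0 => i _.
  by rewrite exprn_gt0// divr_gt0 ?ltr0n.
have q2 : q.[0] ^+ 2 <= K * moment (q ^+ 2).
  (* Up to the factor [K], this is the component of [q] orthogonal to [k]. *)
  have := moment_sqr_ge0 (K *: q - q.[0] *: k).
  rewrite (_ : (K *: q - q.[0] *: k) ^+ 2 = (K ^+ 2) *: (q ^+ 2)
      + (- (K * q.[0] + K * q.[0])) *: (q * k)
      + (q.[0] ^+ 2) *: (k * k)); last first.
    by rewrite -!mul_polyC !(polyCM, polyCD, polyCN); ring.
  rewrite !momentD !momentZ !(moment_kernel _ sk kP)// -/K -horner_coef0.
  rewrite (_ : _ + _ + _ = K * (K * moment (q ^+ 2) - q.[0] ^+ 2)); last by ring.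
  by rewrite pmulr_rge0// subr_ge0.
(* [prod_ratio_le] and p + 1 <= 2p bound [K] by (n + 1) (2p)^(2(n+1)). As 32 p^2 = 8 (2p)^2, there
   remains 2 (n + 1) <= 8^(n+1). *)
have KB : 2 * K <= (32 * p%:R ^+ 2) ^+ n.+1.
  rewrite k0 prodrXl.
  apply: (@le_trans _ _ (2 * (n.+1%:R * ((2 * p%:R) ^+ n.+1) ^+ 2))).
    rewrite !ler_wpM2l// ler_sqr ?nnegrE ?exprn_ge0 ?mulr_ge0//; last first.
      by apply: prodr_ge0 => i _; rewrite divr_ge0.
    rewrite (le_trans (prod_ratio_le _ _ _))// lerXn2r ?nnegrE//.
    by rewrite -natrM ler_nat mul2n -addnn -addn1 leq_add2l.
  rewrite exprAC mulrA.
  rewrite (_ : (32 * p%:R ^+ 2 : R) = 8 * (2 * p%:R) ^+ 2); last by ring.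
  rewrite [leRHS]exprMn ler_wpM2r ?exprn_ge0//.
  rewrite -natrM -natrX ler_nat.
  elim: n => // m IHm; rewrite expnS.
  rewrite (leq_trans _ (leq_mul (isT : 2 <= 8)%N IHm))// leq_mul2l/=.
  by rewrite mul2n -addnn addSnnS leq_addl.
have M0 := moment_sqr_ge0 q.
apply: (le_trans _ (ler_wpM2r M0 KB)).
by rewrite -mulrA ler_wpM2l.
Qed.

End Moment.

(** * Monotonicity of integrals and affine substitution on the line *)

(* The library's ge0_le_integral would ask for the measurability of the
   extension of v by 0 outside the prism. *)
Lemma ge0_le_integralT d (T : measurableType d) (R : realType)
    (mu : {measure set T -> \bar R}) (f g : T -> \bar R) :
  (forall x, 0 <= f x)%E -> (forall x, f x <= g x)%E ->
  (\int[mu]_x f x <= \int[mu]_x g x)%E.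
Proof.
move=> f0 fg; have g0 x : (0 <= g x)%E by exact: le_trans (fg x).
rewrite !ge0_integralTE//; apply: le_ereal_sup => _ [h hf <-].
by exists h => // x; exact: le_trans (fg x).
Qed.

Section AffineR.
Variables (R : realType) (a h : R).
Hypothesis h0 : h != 0.
Local Notation mu := (@lebesgue_measure R).
Let aff : measurableTypeR R -> measurableTypeR R := fun x => a + h * x.

Let maff : measurable_fun [set: measurableTypeR R] aff.
Proof. by apply: measurable_funD => //; exact: measurable_funM. Qed.

(** By uniqueness of the Lebesgue measure, it suffices to compare both sides on the intervals ]u,
    v]. *)
Lemma lebesgue_measure_affine A : measurable A ->
  (mu A = `|h|%:E * mu (aff @^-1` A))%E.
Proof.
pose m := measure_function_pushforward__canonical__measure_function_Measure
  mu maff.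
move=> mA; pose k := NngNum (normr_ge0 h).
rewrite -[RHS]/(mscale k m A); move: A mA.
apply: lebesgue_measure_unique => _ [[u v] _ <-] /=.
rewrite /mscale /= /pushforward.
have [hgt0|hlt0|h00] := ltgtP 0 h; [| |by move: h0; rewrite -h00 eqxx].
- have E (x : R) : (u < a + h * x <= v) <-> ((u - a) / h < x <= (v - a) / h).
    by rewrite ltr_pdivrMr// ler_pdivlMr// ltrBlDl lerBrDl (mulrC x).
  rewrite (_ : _ @^-1` _ = `](u - a) / h, (v - a) / h]%classic); last first.
    by apply/seteqP; split => x /=; rewrite !in_itv; [exact: (E x).1|exact: (E x).2].
  rewrite !lebesgue_measure_itv/= !lte_fin ltr_pM2r ?invr_gt0// ltrD2r.
  case: ifPn => _; last by rewrite mule0.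
  rewrite gtr0_norm// -!EFinB -EFinM; congr EFin; field.
  by rewrite gt_eqF.
(* A negative slope exchanges the open and the closed end of the interval. *)
- have E (x : R) : (u < a + h * x <= v) <-> ((v - a) / h <= x < (u - a) / h).
    by rewrite ltr_ndivlMr// ler_ndivrMr// ltrBlDl lerBrDl (mulrC x) andbC.
  rewrite (_ : _ @^-1` _ = `[(v - a) / h, (u - a) / h[%classic); last first.
    by apply/seteqP; split => x /=; rewrite !in_itv; [exact: (E x).1|exact: (E x).2].
  rewrite !lebesgue_measure_itv/= !lte_fin ltr_nM2r ?invr_lt0// ltrD2r.
  case: ifPn => _; last by rewrite mule0.
  rewrite ltr0_norm// -!EFinB -EFinM; congr EFin; field.
  by rewrite lt_eqF.
Qed.

Lemma ge0_integral_affine (f : R -> \bar R) :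
  measurable_fun [set: R] f -> (forall x, 0 <= f x)%E ->
  (\int[mu]_x f x = `|h|%:E * \int[mu]_x f (a + h * x)%R)%E.
Proof.
move=> mf f0.
pose m := measure_function_pushforward__canonical__measure_function_Measure
  mu maff.
transitivity (\int[mscale (NngNum (normr_ge0 h)) m]_x f x)%E.
  apply: eq_measure_integral => A mA _; exact: lebesgue_measure_affine.
rewrite ge0_integral_mscale//; congr (_ * _)%E.
by rewrite ge0_integral_pushforward//.
Qed.

End AffineR.

(** * Tonelli's theorem and scaling in n dimensions *)

Section LebesgueRnIntegral.
Variable R : realType.

(* A constant for the measure lebesgueRn R n, so that canonical instances (here,
   sigma-finiteness) can be attached to it. *)
Definition lambda n : set (n.-tuple R) -> \bar R := lebesgueRn R n.

HB.instance Definition _ n := Measure.copy (@lambda n) (lebesgueRn R n).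

(** The cubes [-k, k]^n exhaust the space and have finite volume by [lebesgueRn_box]. *)
Lemma lambda_sigma_finite n : sigma_finite [set: n.-tuple R] (@lambda n).
Proof.
exists (fun k => [set x | forall i, `[- k%:R, k%:R]%classic (tnth x i)]).
  apply/esym/seteqP; split => // x _.
  have [k kP] : exists k : nat, forall i, `|tnth x i| <= k%:R.
    exists (\max_i Num.trunc (`|tnth x i|)).+1 => i.
    apply/ltW/(lt_le_trans (truncnS_gt _)).
    rewrite ler_nat ltnS.
    exact: (@leq_bigmax _ (fun i => Num.trunc (`|tnth x i|))).
  exists k => // i /=; rewrite in_itv/= -ler_norml; exact: kP.
move=> k; pose I (_ : 'I_n) : set R := `[- k%:R, k%:R]%classic.
have mI i : measurable (I i) by exact: measurable_itv.
rewrite -[X in measurable X]/[set x : n.-tuple R | forall i, I i (tnth x i)].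
split; first exact: measurable_box.
rewrite /lambda (lebesgueRn_box mI).
rewrite (eq_bigr (fun=> (k%:R - - k%:R)%:E)) => [|i _].
  by rewrite prodEFin ltry.
rewrite lebesgue_measure_itv/= lte_fin; case: ltP => // hk.
have k0 : 0 <= k%:R :> R by [].
by congr EFin; lra.
Qed.

HB.instance Definition _ n :=
  Measure_isSigmaFinite.Build _ _ _ (@lambda n) (@lambda_sigma_finite n).

Lemma lambda_tonelli n (f : n.+1.-tuple R -> \bar R) :
  measurable_fun [set: n.+1.-tuple R] f -> (forall x, 0 <= f x)%E ->
  (\int[@lambda n.+1]_x f x =
   \int[@lambda n]_x \int[lebesgue_measure]_y f (snoc (x, y)))%E.
Proof.
move=> mf f0.
transitivity (\int[(@lambda n \x @lebesgue_measure R)%E]_z f (snoc z))%E.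
  pose m := [the {measure set _ -> \bar R} of
    (@lambda n \x @lebesgue_measure R)%E].
  have ms : measurable_fun [set: n.-tuple R * measurableTypeR R]
    (@snoc R n : n.-tuple R * measurableTypeR R -> _) := @measurable_snoc R n.
  have := ge0_integral_pushforward ms m measurableT mf (fun x _ => f0 x).
  by rewrite preimage_setT => <-.
have mfs : measurable_fun [set: n.-tuple R * measurableTypeR R]
    (f \o @snoc R n : n.-tuple R * measurableTypeR R -> _).
  exact: measurableT_comp mf (@measurable_snoc R n).
exact: (@fubini_tonelli1 _ _ _ _ R (@lambda n) (@lebesgue_measure R)
  _ mfs (fun z => f0 _)).
Qed.

(** With the height as outer variable, a pyramid can be integrated slice by slice. *)
Lemma lambda_tonelli_swap n (f : n.+1.-tuple R -> \bar R) :
  measurable_fun [set: n.+1.-tuple R] f -> (forall x, 0 <= f x)%E ->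
  (\int[@lambda n.+1]_x f x =
   \int[lebesgue_measure]_y \int[@lambda n]_x f (snoc (x, y)))%E.
Proof.
move=> mf f0; rewrite lambda_tonelli//.
have mfs : measurable_fun [set: n.-tuple R * measurableTypeR R]
    (f \o @snoc R n : n.-tuple R * measurableTypeR R -> _).
  exact: measurableT_comp mf (@measurable_snoc R n).
exact: (@fubini_tonelli _ _ _ _ R (@lambda n) (@lebesgue_measure R)
  _ mfs (fun z => f0 _)).
Qed.

Definition affine n (a : n.-tuple R) (s : R) (x : n.-tuple R) : n.-tuple R :=
  [tuple tnth a i + s * tnth x i | i < n].

Lemma measurable_affine n (a : n.-tuple R) s :
  measurable_fun [set: n.-tuple R] (affine a s).
Proof.
apply/measurable_fun_tnthP => i.
rewrite (_ : _ \o _ = fun x => tnth a i + s * tnth x i); last first.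
  by apply/funext => x /=; rewrite tnth_mktuple.
apply: measurable_funD => //; apply: measurable_funM => //.
exact: measurable_tnth.
Qed.

Lemma affine_snoc n (a : n.+1.-tuple R) s x y :
  affine a s (snoc (x, y)) = snoc (affine (base a) s x, height a + s * y).
Proof.
apply: eq_from_tnth => i; rewrite tnth_mktuple.
have [j ->|->] := unliftP ord_max i.
  by rewrite !tnth_snoc_lift !tnth_mktuple.
by rewrite !tnth_snoc_max.
Qed.

(** Induction on the dimension: Tonelli splits off the last coordinate, which contributes one factor
    [s]. *)
Lemma ge0_lambda_affine n (a : n.-tuple R) (s : R) (f : n.-tuple R -> \bar R) :
  0 < s -> measurable_fun [set: n.-tuple R] f -> (forall x, 0 <= f x)%E ->
  (\int[@lambda n]_x f x = (s ^+ n)%:E * \int[@lambda n]_x f (affine a s x))%E.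
Proof.
move=> s0; elim: n => [|n IHn] in a f *; move=> mf f0.
  rewrite mul1e; apply: eq_integral => x _; congr f.
  by apply: eq_from_tnth => -[].
have mfsnoc : measurable_fun setT (f \o @snoc R n).
  exact: measurableT_comp (@measurable_snoc R n).
have mfa : measurable_fun setT (f \o affine a s).
  exact: measurableT_comp (@measurable_affine _ a s).
have mfasnoc : measurable_fun setT (f \o affine a s \o @snoc R n).
  exact: measurableT_comp (@measurable_snoc R n).
rewrite lambda_tonelli// (IHn (base a)); last 2 first.
- exact: (@measurable_fun_fubini_tonelli_F _ _ _ _ R (@lebesgue_measure R)
    _ mfsnoc (fun z => f0 _)).
- by move=> x; apply: integral_ge0.
rewrite lambda_tonelli// exprSr EFinM -muleA; congr (_ * _)%E.
rewrite -ge0_integralZl//; last 3 first.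
- exact: (@measurable_fun_fubini_tonelli_F _ _ _ _ R (@lebesgue_measure R)
    _ mfasnoc (fun z => f0 _)).
- by move=> x _; apply: integral_ge0.
- by rewrite lee_fin ltW.
apply: eq_integral => x _.
rewrite (@ge0_integral_affine _ (height a) s)//; last 2 first.
- by rewrite gt_eqF.
- exact: measurableT_comp mfsnoc (measurable_pair1 _).
rewrite gtr0_norm//; congr (_ * _)%E.
by apply: eq_integral => y _; rewrite affine_snoc.
Qed.

End LebesgueRnIntegral.

(** * Polynomials in several variables and their restrictions to lines *)

Lemma measurable_meval (R : realType) n (P : mpoly n R) d (T : measurableType d)
    (f : T -> 'I_n -> R) :
  (forall i, measurable_fun [set: T] (fun x => f x i)) ->
  measurable_fun [set: T] (fun x => meval (f x) P).
Proof.
move=> mf; under eq_fun do rewrite mevalE.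
apply: measurable_sum => m; apply: measurable_funM => //.
apply: measurable_prod => i _; exact: measurable_funX.
Qed.

(** Substituting the [l i] turns a monomial into a product of polynomials of degree at most 1, as
    many as its total degree. *)
Lemma meval_line (R : comNzRingType) n (P : mpoly n R) p (a b : 'I_n -> R) :
  (msize P <= p.+1)%N ->
  exists2 q : {poly R}, (size q <= p.+1)%N &
    forall s, q.[s] = meval (fun i => a i + s * b i) P.
Proof.
move=> sP; pose l i := (a i)%:P + b i *: 'X.
exists (\sum_(m <- msupp P) (mcoeff m P)%:P * \prod_i l i ^+ m i).
  rewrite big_seq; apply: (big_ind (fun q : {poly R} => size q <= p.+1)%N).
  - by rewrite size_poly0.
  - by move=> q r sq sr; rewrite (leq_trans (size_polyD _ _))// geq_max sq.
  - move=> m mP; rewrite mul_polyC (leq_trans (size_scale_leq _ _))//.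
    apply: leq_trans (leq_trans (msize_mdeg_lt mP) sP); rewrite mdegE.
    elim/big_rec2: _ => [|i q k _ IH]; first by rewrite size_poly1.
    rewrite (leq_trans (size_polyMleq _ _))//.
    have sl : (size (l i) <= 2)%N.
      rewrite (leq_trans (size_polyD _ _))// geq_max.
      rewrite (leq_trans (size_polyC_leq1 _))//=.
      by rewrite (leq_trans (size_scale_leq _ _))// size_polyX.
    have sli : (size (l i ^+ m i) <= (m i).+1)%N.
      rewrite (leq_trans (size_poly_exp_leq _ _))// ltnS.
      by rewrite -[leqRHS]mul1n leq_mul// -subn1 leq_subLR.
    by rewrite -subn1 leq_subLR add1n (leq_trans (leq_add sli IH))// addSn addnS.
move=> s; rewrite horner_sum mevalE; apply: eq_bigr => m _.
rewrite hornerM hornerC; congr (_ * _); rewrite horner_prod; apply: eq_bigr => i _.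
by rewrite horner_exp hornerD hornerC hornerZ hornerX mulrC.
Qed.

(** * Pyramids with a given apex *)

Section Cone.
Variables (R : realType) (n : nat) (z : n.+1.-tuple R) (h : R).
Hypothesis h_neq0 : h != 0.

(* The point z + s (b' - z) for w = (b, s), where b' is b put at height
   height z + h. *)
Definition cone_point (w : n.-tuple R * R) : n.+1.-tuple R :=
  snoc (affine [tuple (1 - w.2) * tnth (base z) i | i < n] w.2 w.1,
        height z + h * w.2).

(* Relative distance of x to the apex plane, i.e., the parameter s of
   cone_point. *)
Definition depth (x : n.+1.-tuple R) : R := (height x - height z) / h.

(* The apex s = 0 is left out so that the parametrization by cone_point is
   injective. *)
Definition cone : set (n.+1.-tuple R) :=
  [set x | 0 < depth x <= 1 /\ forall i,
     0 <= tnth (base x) i - (1 - depth x) * tnth (base z) i <= depth x].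

Lemma height_snoc (w : n.-tuple R * R) : height (snoc w) = w.2.
Proof. exact: tnth_snoc_max. Qed.

Lemma base_snoc (w : n.-tuple R * R) : base (snoc w) = w.1.
Proof. by apply: eq_from_tnth => i; rewrite tnth_mktuple tnth_snoc_lift. Qed.

Lemma snoc_base (x : n.+1.-tuple R) : snoc (base x, height x) = x.
Proof.
apply: eq_from_tnth => i; have [j ->|->] := unliftP ord_max i.
  by rewrite tnth_snoc_lift tnth_mktuple.
by rewrite tnth_snoc_max.
Qed.

Lemma depth_cone_point w : depth (cone_point w) = w.2.
Proof. by rewrite /depth height_snoc/= addrC addKr mulrC mulKf. Qed.

(** In the coordinates (b, s) the pyramid becomes the product of the unit cube and ]0, 1]; the
    factor s > 0 cancels from the inequalities. *)
Lemma cone_pointP b s : cone (cone_point (b, s)) <-> 0 < s <= 1 /\ unit_cube b.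
Proof.
rewrite /cone/= depth_cone_point base_snoc/=.
split=> -[/andP[s0 s1] H]; rewrite s0 s1; split=> // i.
  by have := H i; rewrite !tnth_mktuple addrC addKr pmulr_rge0// ger_pMr.
by rewrite !tnth_mktuple addrC addKr pmulr_rge0// ger_pMr//; exact: H.
Qed.

(** The parametrization is onto: [b] is recovered from [x] by dividing by its depth, which is
    positive because the apex is excluded. *)
Lemma cone_sub (K : set (n.+1.-tuple R)) :
  (forall b s, unit_cube b -> 0 < s <= 1 -> K (cone_point (b, s))) ->
  cone `<=` K.
Proof.
move=> HK x [/[dup] s01 /andP[s0 s1] xC].
pose b := [tuple (tnth (base x) i - (1 - depth x) * tnth (base z) i) / depth x
  | i < n].
have xE : x = cone_point (b, depth x).
  rewrite -[LHS]snoc_base; congr (snoc (_, _)).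
    apply: eq_from_tnth => i; rewrite !tnth_mktuple/=.
    by rewrite [depth x * _]mulrC divfK ?gt_eqF// addrC subrK.
  by rewrite /= /depth mulrC divfK// addrC subrK.
rewrite xE; apply: HK => // i.
rewrite tnth_mktuple divr_ge0 ?(ltW s0)//=; last by case/andP: (xC i).
by rewrite ler_pdivrMr// mul1r; case/andP: (xC i).
Qed.

Lemma measurable_height : measurable_fun [set: n.+1.-tuple R] (@height R n).
Proof. exact: measurable_tnth. Qed.

Lemma measurable_base i :
  measurable_fun [set: n.+1.-tuple R] (fun x => tnth (base x) i).
Proof.
under eq_fun do rewrite tnth_mktuple; exact: measurable_tnth.
Qed.

Lemma measurable_depth : measurable_fun setT depth.
Proof.
apply: measurable_funM => //; apply: measurable_funB => //; exact: measurable_height.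
Qed.

Lemma measurable_cone : measurable cone.
Proof.
have mle (f g : n.+1.-tuple R -> R) : measurable_fun setT f ->
    measurable_fun setT g -> measurable [set x | f x <= g x].
  by move=> mf mg; rewrite -[X in measurable X]setTI; exact: measurable_fun_le.
have md := measurable_depth.
have me i : measurable_fun setT (fun x : n.+1.-tuple R =>
    tnth (base x) i - (1 - depth x) * tnth (base z) i).
  apply: measurable_funB; first exact: measurable_base.
  by apply: measurable_funM => //; apply: measurable_funB.
rewrite [X in measurable X](_ : _ =
   (~` [set x | depth x <= 0] `&` [set x | depth x <= 1]) `&`
   \bigcap_(i in [set: 'I_n])
     ([set x | 0 <= tnth (base x) i - (1 - depth x) * tnth (base z) i] `&`
      [set x | tnth (base x) i - (1 - depth x) * tnth (base z) i <= depth x])).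
  apply: measurableI; first by apply: measurableI; [apply: measurableC|]; exact: mle.
  by apply: fin_bigcap_measurable => // i _; apply: measurableI; exact: mle.
apply/seteqP; split => [x [/andP[d0 d1] xC]|x [[/negP]]].
  split; first by split => //; apply/negP; rewrite -ltNge.
  by move=> i _; apply/andP; exact: xC.
rewrite -ltNge => d0 d1 xC; split; first by apply/andP.
by move=> i; apply/andP; exact: xC.
Qed.

Lemma measurable_cone_point :
  measurable_fun [set: n.-tuple R * R] cone_point.
Proof.
apply/measurable_fun_tnthP => i; have [j ->|->] := unliftP ord_max i.
- rewrite (_ : _ \o _ = fun w : n.-tuple R * R =>
     (1 - w.2) * tnth (base z) j + w.2 * tnth w.1 j); last first.
    by apply/funext => w /=; rewrite tnth_snoc_lift !tnth_mktuple.
  apply: measurable_funD; apply: measurable_funM => //.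
  + exact: measurable_funB.
  + exact: measurableT_comp (measurable_tnth j) measurable_fst.
- rewrite (_ : _ \o _ = fun w : n.-tuple R * R => height z + h * w.2).
    by apply: measurable_funD => //; apply: measurable_funM.
  by apply/funext => w /=; rewrite tnth_snoc_max.
Qed.

End Cone.

(** * Integrals of squared polynomials over a pyramid *)

Lemma lambda_unit_cube (R : realType) n :
  measurable (@unit_cube R n) /\ @lambda R n (@unit_cube R n) = 1%E.
Proof.
pose I (_ : 'I_n) : set R := `[0, 1]%classic.
have mI i : measurable (I i) by exact: measurable_itv.
have -> : @unit_cube R n = [set x | forall i, I i (tnth x i)].
  by apply/seteqP; split => x H i; have := H i; rewrite /I /= in_itv.
split; first exact: measurable_box.
rewrite /lambda (lebesgueRn_box mI) big1// => i _.
by rewrite lebesgue_measure_itv/= lte_fin ltr01 oppr0 adde0.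
Qed.

Section ConeIntegral.
Variables (R : realType) (n : nat) (z : n.+1.-tuple R) (h : R).
Hypothesis h_neq0 : h != 0.
Variable P : mpoly n.+1 R.
Local Notation ev x := (meval (tnth x) P).
Let F (x : n.+1.-tuple R) : \bar R := (\1_(cone z h) x * ev x ^+ 2)%:E.
(** This is [F] in the coordinates (b, s), times the part s^n of the Jacobian. The remaining factor
    |h| comes from the substitution in the height. *)
Let H (w : n.-tuple R * measurableTypeR R) : \bar R :=
  (\1_(`]0, 1]%classic : set R) w.2 * \1_(@unit_cube R n) w.1 *
   (w.2 ^+ n * ev (cone_point z h w) ^+ 2))%:E.

Let mF : measurable_fun setT F.
Proof.
apply/measurable_EFinP; apply: measurable_funM.
  by apply: measurable_indic; exact: measurable_cone.
by apply: measurable_funX; apply: measurable_meval => i; exact: measurable_tnth.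
Qed.

Let F0 x : (0 <= F x)%E.
Proof. by rewrite lee_fin mulr_ge0// sqr_ge0. Qed.

Let mH : measurable_fun setT H.
Proof.
apply/measurable_EFinP; apply: measurable_funM.
  apply: measurable_funM.
    have mI : measurable_fun [set: measurableTypeR R]
        (\1_(`]0, 1]%classic : set R) : _ -> R) by apply: measurable_indic.
    exact: measurableT_comp mI measurable_snd.
  have mQ : measurable_fun [set: n.-tuple R] (\1_(@unit_cube R n) : _ -> R).
    by apply: measurable_indic; have [] := lambda_unit_cube R n.
  exact: measurableT_comp mQ measurable_fst.
apply: measurable_funM; first exact: measurable_funX.
apply: measurable_funX; apply: measurable_meval => i.
exact: measurableT_comp (measurable_tnth i) (measurable_cone_point z h).
Qed.

Let H0 w : (0 <= H w)%E.
Proof.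
rewrite lee_fin indicE; have [|_] := boolP (_ \in _); last by rewrite !mul0r.
rewrite inE /= in_itv/= => /andP[w0 _].
by apply: mulr_ge0 => //; apply: mulr_ge0; rewrite ?sqr_ge0//; apply/exprn_ge0/ltW.
Qed.

(** For [s] in ]0, 1] the slice is the image of the unit cube under the map from b to (1 - s) z + s
    b, of Jacobian s^n. For other [s] both integrands vanish. *)
Let slice s : (\int[@lambda R n]_x F (snoc (x, height z + h * s)%R) =
  \int[@lambda R n]_b H (b, s))%E.
Proof.
have [s01|s01] := boolP (0 < s <= 1); last first.
  rewrite !integral0_eq// => x _.
    rewrite /H/= indicE memNset ?mul0r//=.
    by rewrite in_itv/=; exact/negP.
  rewrite /F indicE memNset ?mul0r//= => -[].
  by rewrite /depth height_snoc/= addrC addKr mulrC mulKf// (negPf s01).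
have /andP[s0 _] := s01.
have ms (c : R) : measurable_fun setT (fun x : n.-tuple R => F (snoc (x, c))).
  apply: measurableT_comp mF _.
  exact: measurableT_comp (@measurable_snoc R n) (measurable_pair2 _).
rewrite (@ge0_lambda_affine _ _ [tuple (1 - s) * tnth (base z) i | i < n] s)//.
rewrite -ge0_integralZl//; last 2 first.
- exact: measurableT_comp (ms _) (@measurable_affine _ _ _ s).
- by rewrite lee_fin exprn_ge0// ltW.
apply: eq_integral => b _.
rewrite /F -/(cone_point z h (b, s)) -EFinM /H/=; congr EFin.
rewrite [in RHS]indicE mem_set/= ?in_itv// mul1r mulrCA; congr (_ * _).
rewrite !indicE; congr ((nat_of_bool _)%:R).
by apply/idP/idP; rewrite !inE cone_pointP// => -[].
Qed.

Lemma cone_integral_ge p : (0 < p)%N -> (msize P <= p.+1)%N ->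
  ((`|h| * (2 * ev z ^+ 2 / (32 * p%:R ^+ 2) ^+ n.+1))%:E <=
   \int[@lambda R n.+1]_x (\1_(cone z h) x * ev x ^+ 2)%:E)%E.
Proof.
move=> p_gt0 sP; rewrite -[leRHS]/(\int[_]_x F x)%E.
set C := _ ^+ n.+1; set k := _ / C.
have C_gt0 : 0 < C by rewrite exprn_gt0// mulr_gt0// exprn_gt0// ltr0n.
(* The height is written as [height z + h * s], which yields the factor |h|. *)
rewrite lambda_tonelli_swap// (@ge0_integral_affine _ (height z) h)//; last 2 first.
- have mFs : measurable_fun [set: n.-tuple R * measurableTypeR R]
      (F \o @snoc R n : n.-tuple R * measurableTypeR R -> _).
    exact: measurableT_comp mF (@measurable_snoc R n).
  exact: (@measurable_fun_fubini_tonelli_G _ _ _ _ R (@lambda R n) _ mFs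
    (fun w => F0 _)).
- by move=> y; apply: integral_ge0.
rewrite EFinM; apply: lee_wpmul2l => //.
under eq_integral do rewrite slice.
(* Now [b] becomes the outer variable, so that the inner integral runs along a ray from the apex. *)
rewrite -(@fubini_tonelli _ _ _ _ R (@lambda R n) (@lebesgue_measure R) H mH H0).
have [mQ Q1] := lambda_unit_cube R n.
have k0 : 0 <= k.
  by apply: divr_ge0; [apply: mulr_ge0 => //; exact: sqr_ge0|exact: ltW].
(* As the unit cube has volume 1, [k] is itself an integral over [b], and it suffices to compare the
   integrands for each [b]. *)
have <- : (\int[@lambda R n]_b (k * \1_(@unit_cube R n) b)%:E = k%:E)%E.
  under eq_integral do rewrite EFinM.
  rewrite ge0_integralZl//.
  - by rewrite integral_indic// setIT [X in (_ * X)%E]Q1 mule1.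
  - by apply/measurable_EFinP/measurable_indic.
apply: ge0_le_integralT => b; first by rewrite lee_fin mulr_ge0.
rewrite indicE; have [|bQ] := boolP (b \in _); last first.
  by rewrite mulr0; apply: integral_ge0.
rewrite inE => bQ; rewrite mulr1.
(* The restriction of [P] to the ray that starts at [z] for s = 0 and reaches the base of the
   pyramid for s = 1. *)
have [q sq qE] := meval_line (tnth z)
  (fun i => tnth (cone_point z h (b, 1)) i - tnth z i) sP.
have q0 : q.[0] = ev z.
  by rewrite qE; apply: meval_eq => i; rewrite mul0r addr0.
have qs s : q.[s] = ev (cone_point z h (b, s)).
  rewrite qE; apply: meval_eq => i; have [j ->|->] := unliftP ord_max i.
    rewrite !tnth_snoc_lift/= !tnth_mktuple; ring.
  by rewrite !tnth_snoc_max/= /height; ring.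
have -> : (\int[lebesgue_measure]_s H (b, s) = (moment n (q ^+ 2))%:E)%E.
  rewrite -integral_moment -integral_itv_obnd_cbnd.
    rewrite [RHS]integral_mkcond; apply: eq_integral => s _.
    rewrite patchE /H/= !indicE [b \in _]mem_set// mulr1.
    by case: ifPn => _; rewrite ?mul0r// mul1r horner_exp qs mulrC.
  apply: measurable_funTS; apply/measurable_EFinP.
  apply: measurable_funM; last exact: measurable_funX.
  by apply: continuous_measurable_fun; exact: continuous_horner.
rewrite lee_fin ler_pdivrMr// [leRHS]mulrC -q0; exact: horner0_sqr_le.
Qed.

End ConeIntegral.

(** * Pyramids inside the prism and the inverse estimate *)

Lemma prism_cone (R : realType) n (phi : n.-tuple R -> R) (z : n.+1.-tuple R) :
  reference_prism phi -> prism phi z ->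
  exists2 h : R, 2^-1 <= `|h| &
    forall b s, unit_cube b -> 0 < s <= 1 -> prism phi (cone_point z h (b, s)).
Proof.
move=> [_ sub_cube seg _] [zQ /andP[z0 zphi]].
have baseQ b s : unit_cube b -> 0 < s <= 1 ->
    unit_cube (affine [tuple (1 - s) * tnth (base z) i | i < n] s b).
  move=> bQ /andP[s0 s1] i; rewrite !tnth_mktuple.
  have /andP[b0 b1] := bQ i; have := zQ i; rewrite tnth_mktuple => /andP[zi0 zi1].
  by apply/andP; split; nra.
have [zle|zgt] := leP (height z) 2^-1.
  exists (1 - height z); first by rewrite ger0_norm; lra.
  move=> b s bQ s01; apply: sub_cube => i; have [j ->|->] := unliftP ord_max i.
    by rewrite tnth_snoc_lift; exact: baseQ.
  rewrite tnth_snoc_max/=; case/andP: s01 => s0 s1.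
  by apply/andP; split; nra.
exists (- height z); first by rewrite normrN ger0_norm// ltW.
move=> b s bQ s01; have /andP[s0 s1] := s01.
(* At parameter 1 - s, the segment from [x] to [y] has the same base coordinates as the cone point
   and height (1 - s) phi, which is at least the height (1 - s) [height z] of the cone point. *)
pose x := snoc (b, 0); pose y := snoc (base z, phi (base z)).
have xF : bottom_face x by rewrite /bottom_face /= base_snoc height_snoc.
have yF : top_face phi y by rewrite /top_face /= base_snoc height_snoc.
have t01 : 0 <= 1 - s <= 1 by apply/andP; split; lra.
have xyE : segment_point x y (1 - s) =
    snoc (affine [tuple (1 - s) * tnth (base z) i | i < n] s b,
          (1 - s) * phi (base z)).
  apply: eq_from_tnth => i; rewrite tnth_mktuple.
  have [j ->|->] := unliftP ord_max i.
    by rewrite !tnth_snoc_lift !tnth_mktuple; ring.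
  by rewrite !tnth_snoc_max/= mulr0 add0r.
have [] := seg x y xF yF _ t01.
rewrite xyE base_snoc height_snoc/= => _ /andP[_ le_phi].
split; first by rewrite base_snoc; exact: baseQ.
rewrite base_snoc height_snoc/=; apply/andP; split; first by nra.
by apply: le_trans le_phi; nra.
Qed.

(** Links the real exponent 2 in [Lnorm] to the algebraic square. *)
Lemma poweR2 (R : realType) (x : \bar R) : (0 <= x)%E -> (x `^ 2 = x ^+ 2)%E.
Proof.
case: x => [r r0| _ |//]; first by rewrite poweR_EFin powR_mulrn// EFin_expe.
by rewrite poweRyr// expe2.
Qed.

Theorem lemma4p16 (R : realType) (n : nat) (phi : n.-tuple R -> R)
    (Kprism : reference_prism phi) (p : nat) (p_gt0 : (0 < p)%N)
    (v : n.+1.-tuple R -> R) (vP : polyfun p (prism phi) v) :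
  (normLoo (prism phi) v ^+ 2
     <= ((32 * p%:R ^+ 2) ^+ n.+1)%:E * normL2 (prism phi) v ^+ 2)%E.
Proof.
have [P sP vE] := vP.
set C := _ ^+ n.+1.
have C_gt0 : 0 < C by rewrite exprn_gt0// mulr_gt0// exprn_gt0// ltr0n.
have -> : (normL2 (prism phi) v ^+ 2 =
    \int[@lambda R n.+1]_x ((v \_ (prism phi)) x ^+ 2)%:E)%E.
  rewrite -poweR2 ?Lnorm_ge0// /normL2 poweR_Lnorm ?pnatr_eq0//.
  apply: eq_integral => x _; rewrite poweR2//= -EFinM -expr2.
  by rewrite real_normK// num_real.
set I := (\int[_]_x _)%E.
(* The bound holds at every point; outside the prism the extension of [v] is 0. *)
have pointwise x : (((v \_ (prism phi)) x ^+ 2)%:E <= C%:E * I)%E.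
  have I0 : (0 <= I)%E by apply: integral_ge0 => ? _; rewrite lee_fin sqr_ge0.
  rewrite patchE; case: ifPn => [|_]; last first.
    by rewrite expr0n mule_ge0// lee_fin ltW.
  rewrite inE => xK; rewrite vE//.
  have [h h12 hK] := prism_cone Kprism xK.
  have h0 : h != 0 by rewrite -normr_gt0; apply: lt_le_trans h12; rewrite invr_gt0.
  have coneI := cone_integral_ge x h0 p_gt0 sP.
  have IcI : (\int[@lambda R n.+1]_y
      (\1_(cone x h) y * meval (tnth y) P ^+ 2)%:E <= I)%E.
    apply: ge0_le_integralT => y; rewrite lee_fin.
      by rewrite mulr_ge0// sqr_ge0.
    rewrite indicE; have [|_] := boolP (y \in _); last by rewrite mul0r sqr_ge0.
    rewrite inE mul1r => /(cone_sub h0 hK) yK.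
    by rewrite patchE mem_set// vE.
  apply: le_trans (lee_wpmul2l _ (le_trans coneI IcI)); last first.
    by rewrite lee_fin ltW.
  (* After multiplication by [C], the lower bound for the pyramid is 2 |h| P(x)^2, and 2 |h| >=
     1. *)
  rewrite -EFinM lee_fin mulrCA [_ * (_ / _)]mulrC divfK ?gt_eqF// mulrA.
  by rewrite ler_peMl ?sqr_ge0// -ler_pdivrMr// mul1r.
have I0 : (0 <= I)%E by apply: integral_ge0 => x _; rewrite lee_fin sqr_ge0.
(* If the integral is infinite, so is the right-hand side, since C > 0. *)
case: I I0 pointwise => [r| _ _ |//]; last by rewrite gt0_muley ?lte_fin// leey.
rewrite lee_fin => r0 pointwise.
have Cr0 : 0 <= C * r by rewrite mulr_ge0// ltW.
have -> : (C%:E * r%:E = (Num.sqrt (C * r))%:E ^+ 2)%E.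
  by rewrite expe2 -!EFinM -expr2 sqr_sqrtr.
rewrite lee_sqr ?lee_fin ?sqrtr_ge0 ?Lnorm_ge0//.
(* At exponent [+oo], [Lnorm] is the essential supremum, with default value 0 on a space of measure
   zero. The bound at every point holds in particular almost everywhere. *)
rewrite /normLoo unlock; case: ifPn => _; last by rewrite lee_fin sqrtr_ge0.
apply/ess_supP; apply: nearW => x /=.
rewrite lee_fin -sqrtr_sqr ler_sqrt//.
by have := pointwise x; rewrite -EFinM lee_fin.
Qed.
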